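(* Let $d\ge2$. If there exists a Hadamard matrix of order $n$, then there exists an $(n^2,d,1)$-Hadamard hypercube and there exists a symmetric $(n^2,d,n(n-1)/2,n(n-2)/4)$-design.
   Context: A Hadamard matrix of order $n$ is an $n\times n$ $\pm1$-matrix $H$ with $HH^\top=nI$. A $d$-dimensional hypercube of order $N$ has cells indexed by $[N]^d$; an $\ell$-layer is the sub-array obtained by fixing $d-\ell$ coordinates and letting the other $\ell$ vary; two distinct layers are parallel if they fix the same set of coordinates, and orthogonal if the sum of products of corresponding entries is $0$. For $\ell\in[d-1]$ an $(N,d,\ell)$-Hadamard hypercube is a $d$-dimensional $\pm1$-hypercube of order $N$ in which every two parallel $\ell$-layers are orthogonal. The incidence matrix of a symmetric $(v,k,\lambda)$ design is a $v\times v$ $\{0,1\}$-matrix with exactly $k$ ones in each row and column and in which any two distinct rows, and any two distinct columns, have dot product $\lambda$. A symmetric $(v,d,k,\lambda)$-design is a $\{0,1\}$-hypercube of order $v$ and dimension $d$ in which every $2$-layer is the incidence matrix of a symmetric $(v,k,\lambda)$ design.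
   Formalization: Two parallel layers are required to be orthogonal only when their fixed values differ in exactly one coordinate; requiring it of all distinct layers fixing the same coordinates is impossible for d≥3, n≥2 (e.g. n=2, d=3: 16 orthogonal vectors in R^4). *)

(* Defs.v *)
From mathcomp Require Import all_boot all_order all_algebra.

Set Implicit Arguments.
Unset Strict Implicit.
Unset Printing Implicit Defensive.

Import GRing.Theory.
Local Open Scope ring_scope.

Definition is_hadamard (n : nat) (H : 'M[int]_n) : Prop :=
  (forall i j, H i j = 1 \/ H i j = -1) /\ H *m H^T = (n%:R)%:M.

Definition cell (N d : nat) := {ffun 'I_d -> 'I_N}.

(* The layer fixing the coordinates in F to the values they have in c; it is
   an l-layer when #|F| = d - l. The values of c outside F are irrelevant. *)
Definition layer (N d : nat) (F : {set 'I_d}) (c : cell N d) :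
    {set cell N d} :=
  [set x : cell N d | [forall i in F, x i == c i]].

(* The cell of [layer F c] that corresponds to the cell x of a layer fixing
   the same set F of coordinates: the coordinates outside F are kept. *)
Definition corresponding (N d : nat) (F : {set 'I_d}) (c x : cell N d) :
    cell N d :=
  [ffun i => if i \in F then c i else x i].

Definition orthogonal_layers (N d : nat) (A : cell N d -> int)
    (F : {set 'I_d}) (c c' : cell N d) : Prop :=
  \sum_(x in layer F c) A x * A (corresponding F c' x) = 0.

(* Parallel l-layers fix the same coordinates and lie in a common
   (l+1)-layer, that is, the fixed values differ in exactly one coordinate.
   Orthogonality cannot be asked of all pairs of distinct layers fixing the
   same coordinates: there are N^(d-l) of them, and nonzero pairwise orthogonal
   vectors of length N^l number at most N^l. For l = d-1 the two notions
   coincide. *)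
Definition parallel_layers (N d : nat) (F : {set 'I_d}) (c c' : cell N d) :
    Prop :=
  #|[set i in F | c i != c' i]| = 1%N.

Definition is_hadamard_hypercube (N d l : nat) (A : cell N d -> int) : Prop :=
  [/\ (1 <= l <= d.-1)%N,
      forall x, A x = 1 \/ A x = -1
    & forall (F : {set 'I_d}) (c c' : cell N d),
        #|F| = (d - l)%N -> parallel_layers F c c' ->
        orthogonal_layers A F c c'].

(* The parameters k and lambda are rational, so that expressions such as
   n(n-2)/4 are taken exactly, without integer division. *)
Definition is_symmetric_design_matrix (v : nat) (k lambda : rat)
    (M : 'M[rat]_v) : Prop :=
  [/\ forall i j, M i j = 0 \/ M i j = 1,
      forall i, #|[set j | M i j == 1]|%:R = k,
      forall j, #|[set i | M i j == 1]|%:R = k,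
      forall i i', i != i' -> \sum_j M i j * M i' j = lambda
    & forall j j', j != j' -> \sum_i M i j * M i j' = lambda].

(* The 2-layer in which coordinates p (row index) and q (column index) vary and
   the other coordinates are fixed as in c. *)
Definition layer_matrix (N d : nat) (A : cell N d -> rat) (p q : 'I_d)
    (c : cell N d) : 'M[rat]_N :=
  \matrix_(a < N, b < N)
    A [ffun i => if i == p then a else if i == q then b else c i].

Definition is_symmetric_design (v d : nat) (k lambda : rat)
    (A : cell v d -> rat) : Prop :=
  (forall x, A x = 0 \/ A x = 1) /\
  (forall (p q : 'I_d) (c : cell v d), (p < q)%N ->
     is_symmetric_design_matrix k lambda (layer_matrix A p q c)).

(* Main.v *)
(** Normalise the Hadamard matrix to a matrix [K] of order [n] whose column [0]
    is constantly [1], index [n^2] by pairs [(i, j)] of residues mod [n], and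
    put [A ((i_1, j_1), ..., (i_d, j_d)) = prod_t K i_t s] with
    [s = j_1 + ... + j_d mod n].  Along a line in direction [p], summing over
    [i_p] first leaves by column orthogonality only the term [s = 0], which is
    [n]: so every line sum is [n].  The scalar product of two parallel lines
    that differ only in the coordinate [q] vanishes by column orthogonality if
    [j_q] differs, and by row orthogonality if [j_q] is the same and [i_q]
    differs.  Hence every 2-layer is a Hadamard matrix with all row and column
    sums equal to [n], and [(1 - A) / 2] is the design. *)
Require Import Defs.
From mathcomp Require Import all_boot all_order all_algebra.
From mathcomp Require Import ring.

Set Implicit Arguments.
Unset Strict Implicit.
Unset Printing Implicit Defensive.

Import GRing.Theory Num.Theory.
Local Open Scope ring_scope.

(** * Cells with one coordinate replaced, and indices as pairs *)

Definition update (N d : nat) (c : cell N d) (p : 'I_d) (a : 'I_N) : cell N d :=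
  [ffun i => if i == p then a else c i].

Lemma update_swap (N d : nat) (c : cell N d) (p q : 'I_d) (a b : 'I_N) :
  p != q ->
  update (update c p a) q b = update (update c q b) p a.
Proof.
move=> pq; apply/ffunP => i; rewrite !ffunE.
by case: (eqVneq i q) => // ->; rewrite eq_sym (negPf pq).
Qed.

Lemma bij_square_ord (n : nat) :
  exists phi : 'I_(n ^ 2) -> 'I_n * 'I_n, bijective phi.
Proof.
have eqc : #|{: 'I_n * 'I_n}| = (n ^ 2)%N by rewrite card_prod card_ord.
exists (fun a => enum_val (cast_ord (esym eqc) a)).
exists (fun u => cast_ord eqc (enum_rank u)) => u.
  by rewrite enum_valK cast_ordKV.
by rewrite cast_ordK enum_rankK.
Qed.

(** * Column orthogonality and normalisation of Hadamard matrices *)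

Lemma hadamard_mul_trmx (n : nat) (H : 'M[int]_n) :
  is_hadamard H -> H^T *m H = (n%:R)%:M.
Proof.
case: n H => [|m] H [_ HHt]; first by rewrite [LHS]flatmx0 [RHS]flatmx0.
have detH : \det H != 0.
  apply/eqP => det0; have := congr1 determinant HHt.
  rewrite det_mulmx det0 mul0r det_scalar => /esym/eqP.
  by rewrite expf_eq0 pnatr_eq0 andbF.
apply/eqP; rewrite -subr_eq0.
(* Over [int] the matrix [H] cannot be inverted, so [\det H] is written as [\adj H *m H]; then
   [H *m H^T] appears and the two terms cancel. *)
have : \det H *: (H^T *m H - m.+1%:R%:M) == 0.
  rewrite -mul_scalar_mx -mul_adj_mx -mulmxA mulmxBr mulmxA HHt.
  by rewrite mul_scalar_mx mul_mx_scalar subrr mulmx0.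
by rewrite scalemx_eq0 (negPf detH).
Qed.

Definition normalized_hadamard (m : nat) (K : 'M[int]_m.+1) : Prop :=
  [/\ forall i j, K i j = 1 \/ K i j = -1,
      forall i, K i 0 = 1,
      forall s s', \sum_i K i s * K i s' = m.+1%:R *+ (s == s')
    & forall i i', \sum_s K i s * K i' s = m.+1%:R *+ (i == i')].

Lemma sign_mul (R : pzRingType) (x y : R) :
  x = 1 \/ x = -1 -> y = 1 \/ y = -1 -> x * y = 1 \/ x * y = -1.
Proof.
case=> ->; case=> ->; rewrite ?mul1r ?mulr1 ?mulrNN ?mulr1.
- by left.
- by right.
- by right.
- by left.
Qed.

Lemma sign_sqr (R : pzRingType) (x : R) : x = 1 \/ x = -1 -> x * x = 1.
Proof. by case=> ->; rewrite ?mulrNN mulr1. Qed.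

Lemma normalize_hadamard (m : nat) (H : 'M[int]_m.+1) :
  is_hadamard H -> exists K : 'M[int]_m.+1, normalized_hadamard K.
Proof.
move=> hadH; have HtH := hadamard_mul_trmx hadH.
case: hadH => sH HHt.
(* Each row is multiplied by its own entry in column 0. These signs square away in products of
   columns and factor out of products of rows. *)
exists (\matrix_(i, j) (H i j * H i 0)); split=> [i j|i|s s'|i i'].
- by rewrite mxE; apply: sign_mul.
- by rewrite mxE sign_sqr.
- transitivity ((H^T *m H) s s'); last by rewrite HtH mxE.
  rewrite mxE; apply: eq_bigr => i _; rewrite !mxE mulrACA.
  by rewrite (sign_sqr (sH i 0)) mulr1.
- transitivity (H i 0 * H i' 0 * (H *m H^T) i i').
    rewrite mxE mulr_sumr; apply: eq_bigr => s _; rewrite !mxE.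
    by rewrite mulrACA mulrC.
  rewrite HHt mxE; case: eqP => [->|_]; last by rewrite mulr0n mulr0.
  by rewrite sign_sqr // mul1r.
Qed.

(** * The hypercube and its lines *)

Section Hypercube.

Variables (m N d : nat) (K : 'M[int]_m.+1) (phi : 'I_N -> 'I_m.+1 * 'I_m.+1).
Hypotheses (hadK : normalized_hadamard K) (bij_phi : bijective phi).

Implicit Types (c x : cell N d) (p q : 'I_d).

Definition hadamard_cube x : int :=
  \prod_t K (phi (x t)).1 (\sum_u (phi (x u)).2).

Lemma hadamard_cube_sign x : hadamard_cube x = 1 \/ hadamard_cube x = -1.
Proof.
case: hadK => sK _ _ _.
by apply: (big_ind (fun y : int => y = 1 \/ y = -1)) => //;
  [left | apply: sign_mul].
Qed.

(** Along a line in direction [p], [(phi a).1] enters only one factor, while [(phi a).2] only shifts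
    the common column index by the constant [S]. *)
Lemma hadamard_cube_update c p a (S := \sum_(u | u != p) (phi (c u)).2) :
  hadamard_cube (update c p a) =
  K (phi a).1 ((phi a).2 + S) *
  \prod_(t | t != p) K (phi (c t)).1 ((phi a).2 + S).
Proof.
rewrite /hadamard_cube (bigD1 p) //= ffunE eqxx.
have -> : \sum_u (phi (update c p a u)).2 = (phi a).2 + S.
  rewrite (bigD1 p) //= ffunE eqxx; congr (_ + _).
  by apply: eq_bigr => u /negPf up; rewrite ffunE up.
by congr (_ * _); apply: eq_bigr => u /negPf up; rewrite ffunE up.
Qed.

Lemma sum_phi (F : 'I_m.+1 -> 'I_m.+1 -> int) :
  \sum_a F (phi a).1 (phi a).2 = \sum_j \sum_i F i j.
Proof.
rewrite exchange_big pair_bigA /=.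
by rewrite (reindex phi) //=; apply: onW_bij.
Qed.

Lemma hadamard_cube_line_sum c p :
  \sum_a hadamard_cube (update c p a) = m.+1%:R.
Proof.
case: hadK => _ K0 Kcol _.
under eq_bigr do rewrite hadamard_cube_update.
set S := \sum_(u | u != p) _.
rewrite (sum_phi (fun i j => K i (j + S) *
  \prod_(t | t != p) K (phi (c t)).1 (j + S))).
under eq_bigr => j _.
  (* The factor [K i 0 = 1] is inserted to turn the sum over [i] into the product of columns [j + S]
     and 0. *)
  have -> : \sum_i (K i (j + S) *
      \prod_(t | t != p) K (phi (c t)).1 (j + S)) =
    \sum_i K i (j + S) * K i 0 * \prod_(t | t != p) K (phi (c t)).1 (j + S).
    by apply: eq_bigr => i _; rewrite K0 mulr1.
  rewrite -mulr_suml Kcol.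
  over.
rewrite /= (reindex_inj (addIr (- S))) /=.
under eq_bigr do rewrite addrNK.
rewrite (bigD1 0) //= [X in _ + X]big1 => [|j /negPf ->]; last by rewrite mul0r.
by rewrite addr0 [X in _ * X]big1 ?mulr1 // => t _; rewrite K0.
Qed.

(** Agreement at [p] is not asked, since [update] overwrites that coordinate in both cells. *)
Lemma hadamard_cube_line_orth c c' p q :
  q != p -> c q != c' q -> (forall t, t != p -> t != q -> c t = c' t) ->
  \sum_a hadamard_cube (update c p a) * hadamard_cube (update c' p a) = 0.
Proof.
move=> qp cq cE; case: hadK => sK _ Kcol Krow.
under eq_bigr do rewrite !hadamard_cube_update.
set S := \sum_(u | u != p) _; set S' := \sum_(u | u != p) (phi (c' u)).2.
rewrite (sum_phi (fun i j => K i (j + S) *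
  (\prod_(t | t != p) K (phi (c t)).1 (j + S)) * (K i (j + S') *
  \prod_(t | t != p) K (phi (c' t)).1 (j + S')))) /=.
(* The sum over [i] is the product of columns [j + S] and [j + S'], which is nonzero only if
   [S = S']. *)
under eq_bigr => j _ do
  [under eq_bigr do rewrite mulrACA;
   rewrite -mulr_suml Kcol (inj_eq (addrI j))].
case: (eqVneq S S') => [eqS|_]; last first.
  by rewrite big1 // => j _; rewrite mulr0n mul0r.
rewrite -eqS -mulr_sumr mulr1n.
have eq2 : (phi (c q)).2 = (phi (c' q)).2.
  move: eqS; rewrite /S /S' (bigD1 q) //= [RHS](bigD1 q) //=.
  rewrite (eq_bigr (fun t => (phi (c' t)).2)); first by move/addIr.
  by move=> t /andP[tp tq]; rewrite cE.
have ne1 : (phi (c q)).1 != (phi (c' q)).1.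
  apply: contra cq => /eqP eq1; apply/eqP/(bij_inj bij_phi).
  by rewrite [LHS]surjective_pairing [RHS]surjective_pairing eq1 eq2.
(* The factors at [t] other than [p] and [q] occur squared, so only the product of two distinct rows
   of [K] remains. *)
under eq_bigr => j _.
  rewrite -big_split /= (bigD1 q) //= [X in _ * X]big1 ?mulr1.
    over.
  by move=> t /andP[tp tq]; rewrite cE // sign_sqr.
rewrite (reindex_inj (addIr (- S))) /=.
under eq_bigr do rewrite addrNK.
by rewrite Krow (negPf ne1) mulr0.
Qed.

End Hypercube.

Lemma hadamard_cube_is_hadamard (m N d : nat) (K : 'M[int]_m.+1)
    (phi : 'I_N -> 'I_m.+1 * 'I_m.+1) :
  (2 <= d)%N -> normalized_hadamard K -> bijective phi ->
  is_hadamard_hypercube 1 (@hadamard_cube m N d K phi).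
Proof.
move=> hd hadK bphi; split=> [|x|F c c' cardF]; first by case: d hd => [|[]].
  exact: hadamard_cube_sign.
rewrite /parallel_layers /orthogonal_layers => /eqP/cards1P[q Fq].
have /cards1P[p Fp] : #|~: F| == 1%N.
  by rewrite cardsCs setCK cardF card_ord subKn // (leq_trans _ hd).
have inF t : (t \in F) = (t != p) by rewrite -[F]setCK Fp !inE.
have [qp cq] : q != p /\ c q != c' q.
  by apply/andP; have := set11 q; rewrite -Fq inE inF.
(* The layer is the line through [c] in direction [p], parametrised by the value at [p]. *)
rewrite (reindex (update c p)) /=; last first.
  exists (fun x : cell N d => x p) => [a _|x]; first by rewrite ffunE eqxx.
  rewrite inE => /forall_inP xF; apply/ffunP => t; rewrite ffunE.
  by case: (eqVneq t p) => [->|tp] //; apply/esym/eqP/xF; rewrite inF.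
rewrite (eq_bigl xpredT) => [|a]; last first.
  rewrite inE; apply/forall_inP => t.
  by rewrite inF ffunE => /negPf ->.
under eq_bigr => a _.
  have -> : corresponding F c' (update c p a) = update c' p a.
    by apply/ffunP => t; rewrite !ffunE inF; case: eqP.
  over.
apply: (hadamard_cube_line_orth hadK bphi qp cq) => // t tp tq.
by apply/eqP; apply: contraNT tq => ct; rewrite -in_set1 -Fq inE inF tp.
Qed.

(** * Symmetric designs from the 2-layers *)

Lemma card_sum01 (I : finType) (F : I -> rat) :
  (forall j, F j = 0 \/ F j = 1) -> #|[set j | F j == 1]|%:R = \sum_j F j.
Proof.
move=> F01; rewrite -sum1_card natr_sum big_mkcond /=.
by apply: eq_bigr => j _; rewrite inE; case: (F01 j) => ->.
Qed.

Lemma sum_indicator_neg (v : nat) (f : 'I_v -> int) :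
  \sum_j (1 - (f j)%:~R) / 2 = (v%:R - (\sum_j f j)%:~R) / 2 :> rat.
Proof.
by rewrite -mulr_suml sumrB rmorph_sum /= sumr_const card_ord.
Qed.

Lemma sum_indicator_neg_mul (v : nat) (f g : 'I_v -> int) :
  \sum_j ((1 - (f j)%:~R) / 2) * ((1 - (g j)%:~R) / 2) =
  (v%:R - (\sum_j f j)%:~R - (\sum_j g j)%:~R + (\sum_j f j * g j)%:~R) / 4
    :> rat.
Proof.
have -> : v%:R = \sum_(j < v) (1 : rat) by rewrite sumr_const card_ord.
rewrite !rmorph_sum /= -!sumrB -big_split /=.
rewrite mulr_suml; apply: eq_bigr => j _; rewrite rmorphM /=.
by field.
Qed.

(** Summing [(1 - x) / 2] over a line gives [(n^2 - n) / 2]; summing [(1 - x) (1 - y) / 4] over two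
    orthogonal lines gives [(n^2 - n - n + 0) / 4]. *)
Lemma symmetric_design_of_hadamard (v n : nat) (M : 'M[int]_v) :
  v = (n ^ 2)%N -> (forall i j, M i j = 1 \/ M i j = -1) ->
  (forall i, \sum_j M i j = n%:R) -> (forall j, \sum_i M i j = n%:R) ->
  (forall i i', i != i' -> \sum_j M i j * M i' j = 0) ->
  (forall j j', j != j' -> \sum_i M i j * M i j' = 0) ->
  is_symmetric_design_matrix (n%:R * (n%:R - 1) / 2) (n%:R * (n%:R - 2) / 4)
    (\matrix_(i, j) ((1 - (M i j)%:~R) / 2)).
Proof.
move=> vE sM rowM colM row_orth col_orth.
have M01 i j : (1 - (M i j)%:~R) / 2 = 0 :> rat \/
    (1 - (M i j)%:~R) / 2 = 1 :> rat.
  by case: (sM i j) => ->; [left | right].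
have vR : v%:R = n%:R * n%:R :> rat by rewrite vE natrX expr2.
split=> [i j|i|j|i i' ne|j j' ne]; first by rewrite mxE.
- rewrite card_sum01 => [|j]; last by rewrite mxE.
  under eq_bigr do rewrite mxE.
  by rewrite sum_indicator_neg rowM vR rmorph_nat mulrBr mulr1.
- rewrite card_sum01 => [|i]; last by rewrite mxE.
  under eq_bigr do rewrite mxE.
  by rewrite sum_indicator_neg colM vR rmorph_nat mulrBr mulr1.
- under eq_bigr do rewrite !mxE.
  rewrite sum_indicator_neg_mul !rowM row_orth // vR rmorph_nat.
  by field.
- under eq_bigr do rewrite !mxE.
  rewrite sum_indicator_neg_mul !colM col_orth // vR rmorph_nat.
  by field.
Qed.

Lemma hadamard_cube_design (m d : nat) (K : 'M[int]_m.+1)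
    (phi : 'I_(m.+1 ^ 2) -> 'I_m.+1 * 'I_m.+1) (n := m.+1) :
  normalized_hadamard K -> bijective phi ->
  is_symmetric_design (n%:R * (n%:R - 1) / 2) (n%:R * (n%:R - 2) / 4)
    (fun x : cell (n ^ 2) d => (1 - (hadamard_cube K phi x)%:~R) / 2).
Proof.
move=> hadK bphi.
have sA := @hadamard_cube_sign m _ d K phi hadK.
split=> [x|p q c ltpq].
  by case: (sA x) => ->; [left | right].
have pq : p != q by apply: contraTneq ltpq => ->; rewrite ltnn.
pose M : 'M[int]_(n ^ 2) :=
  \matrix_(a, b) hadamard_cube K phi (update (update c p a) q b).
have -> : layer_matrix
    (fun x : cell (n ^ 2) d => (1 - (hadamard_cube K phi x)%:~R) / 2)
    p q c = \matrix_(a, b) ((1 - (M a b)%:~R) / 2).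
  apply/matrixP => a b; rewrite !mxE.
  congr ((1 - (hadamard_cube _ _ _)%:~R) / 2).
  apply/ffunP => i; rewrite !ffunE.
  by case: (eqVneq i p) => [->|//]; rewrite (negPf pq).
apply: symmetric_design_of_hadamard => // [a b|a|b|a a' ne|b b' ne].
- by rewrite mxE.
- under eq_bigr do rewrite mxE.
  exact: hadamard_cube_line_sum.
- under eq_bigr do rewrite mxE update_swap //.
  exact: hadamard_cube_line_sum.
(* Rows are lines in direction [q] whose base cells differ at [p]; for columns, [update_swap]
   exchanges the two roles. *)
- under eq_bigr do rewrite !mxE.
  apply: (hadamard_cube_line_orth hadK bphi (q := p)) => //.
    by rewrite !ffunE eqxx.
  by move=> t _ /negPf tp; rewrite !ffunE tp.
- under eq_bigr do rewrite !mxE !(update_swap _ _ _ pq).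
  apply: (hadamard_cube_line_orth hadK bphi (q := q)) => //.
  + by rewrite eq_sym.
  + by rewrite !ffunE eqxx.
  by move=> t _ /negPf tq; rewrite !ffunE tq.
Qed.

Theorem theorem6p3 (d n : nat) (hd : (2 <= d)%N)
    (hH : exists H : 'M[int]_n, is_hadamard H) :
  (exists A : cell (n ^ 2) d -> int, is_hadamard_hypercube 1 A) /\
  (exists A : cell (n ^ 2) d -> rat,
     is_symmetric_design (n%:R * (n%:R - 1) / 2) (n%:R * (n%:R - 2) / 4) A).
Proof.
case: n hH => [|m] [H hadH].
  (* For [n = 0] there are no cells: a coordinate exists because [d] is positive, but it has no
     possible value. Constant functions then serve as witnesses. *)
  have cellF (c : cell (0 ^ 2) d) : False.
    by case: (c (Ordinal (ltnW hd))).
  split.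
    exists (fun=> 1); split=> [|x|F c].
    - by case: d hd {cellF} => [|[]].
    - by left.
    - by case: (cellF c).
  by exists (fun=> 0); split=> [x|p q c]; [left | case: (cellF c)].
have [K hadK] := normalize_hadamard hadH.
have [phi bphi] := bij_square_ord m.+1.
split; first by eexists; apply: hadamard_cube_is_hadamard hd hadK bphi.
by eexists; apply: hadamard_cube_design hadK bphi.
Qed.
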